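(* Consider a Latin cube of sort (LC2) on an underlying set $\Omega$, with coordinate partitions $P_1$, $P_2$ and $P_3$, and letter partition $L$. Then the Latin cube is regular if and only if there is a group $T$ such that, up to relabelling the letters and the three sets of coordinates, $\Omega=T^3$ and $L$ is the coset partition (the partition into right cosets) defined by the diagonal subgroup $\{(t,t,t)\mid t\in T\}$. Moreover, $T$ is unique up to group isomorphism.
   Context: Sets and groups may be infinite. For partitions $P,Q$ of a set $\Omega$, $P\wedge Q$ is the partition whose parts are the non-empty intersections of a part of $P$ with a part of $Q$. A Cartesian decomposition of $\Omega$ of dimension $n$ is a set of $n$ partitions $P_1,\ldots,P_n$, each with at least two parts, such that $|p_1\cap\cdots\cap p_n|=1$ for all choices of parts $p_i\in P_i$. Latin cube of sort (LC2): $\Omega$ is a cube $\Omega_1\times\Omega_2\times\Omega_3$ with $|\Omega_1|=|\Omega_2|=|\Omega_3|$, $P_i$ is the partition of $\Omega$ according to the $i$th coordinate (so $\{P_1,P_2,P_3\}$ is a Cartesian decomposition of $\Omega$ with $|P_1|=|P_2|=|P_3|$), and $L$ is a partition of $\Omega$ (whose parts are called letters) such that each letter occurs exactly once in each layer, where the layers are the parts of $P_1$, $P_2$ and $P_3$; equivalently, $\{L,P_i\}$ is a Cartesian decomposition of $\Omega$ for $i=1,2,3$. Lines are the parts of $P_1\wedge P_2$, $P_1\wedge P_3$ and $P_2\wedge P_3$; two lines are parallel if they are parts of the same $P_i\wedge P_j$ ($i\neq j$). A Latin cube of sort (LC2) is regular if, whenever $\ell_1$ and $\ell_2$ are parallel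 lines, the set of letters occurring in $\ell_1$ is either exactly the same as the set of letters occurring in $\ell_2$ or disjoint from it. ''Up to relabelling the letters and the three sets of coordinates, $\Omega=T^3$'' means that the parts of each of $P_1,P_2,P_3$ can be labelled bijectively by the elements of $T$, thereby identifying $\Omega$ with $T^3$ so that $P_i$ is the partition by the $i$th coordinate. *)

(* Defs.v *)
From mathcomp Require Import all_boot.
From mathcomp Require Import boolp classical_sets functions cardinality.
Set Implicit Arguments.
Unset Strict Implicit.
Unset Printing Implicit Defensive.
Local Open Scope classical_set_scope.
Local Open Scope card_scope.
Local Open Scope group_scope.

(* A partition of Omega is the set of its parts. *)
Definition is_partition (Omega : Type) (P : set (set Omega)) : Prop :=
  partition P id [set: Omega].

Definition partition_meet (Omega : Type) (P Q : set (set Omega)) :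
    set (set Omega) :=
  [set r | r !=set0 /\ exists p q, [/\ P p, Q q & r = p `&` q]].

(* The partitions P i are automatically pairwise distinct: a common partition
   would have two distinct parts, whose intersection is empty. *)
Definition cartesian_decomposition (Omega : Type) (n : nat)
    (P : 'I_n -> set (set Omega)) : Prop :=
  [/\ forall i, is_partition (P i),
      forall i, exists p q, [/\ P i p, P i q & p <> q]
    & forall p : 'I_n -> set Omega, (forall i, P i (p i)) ->
        exists w, \bigcap_i p i = [set w]].

(* Omega is not literally a product; the coordinate partitions P exhibit it as
   a cube. *)
Definition latin_cube (Omega : Type) (P : 'I_3 -> set (set Omega))
    (L : set (set Omega)) : Prop :=
  [/\ cartesian_decomposition P,
      forall i j, P i #= P j,
      is_partition L
    & forall i (layer letter : set Omega), P i layer -> L letter ->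
        exists w, layer `&` letter = [set w]].

Definition parallel_lines (Omega : Type) (P : 'I_3 -> set (set Omega))
    (l1 l2 : set Omega) : Prop :=
  exists i j, [/\ i != j, partition_meet (P i) (P j) l1
                        & partition_meet (P i) (P j) l2].

Definition letters_in (Omega : Type) (L : set (set Omega)) (l : set Omega) :
    set (set Omega) :=
  [set a | L a /\ a `&` l !=set0].

Definition regular_cube (Omega : Type) (P : 'I_3 -> set (set Omega))
    (L : set (set Omega)) : Prop :=
  forall l1 l2, parallel_lines P l1 l2 ->
    letters_in L l1 = letters_in L l2 \/
    letters_in L l1 `&` letters_in L l2 = set0.

Definition right_coset_partition (G : groupType) (H : set G) : set (set G) :=
  [set [set h * g | h in H] | g in [set: G]].

(* T ^ 3 is {ffun 'I_3 -> T}, with the pointwise group law. *)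
Definition diagonal_subgroup (T : groupType) : set {ffun 'I_3 -> T} :=
  [set [ffun=> t] | t in [set: T]].
Arguments diagonal_subgroup : clear implicits.

(* lab i labels the parts of P i by T, and phi sends a point to the triple of
   labels of the parts containing it. *)
Definition coordinatisation (Omega : Type) (P : 'I_3 -> set (set Omega))
    (T : groupType) (lab : 'I_3 -> set Omega -> T)
    (phi : Omega -> {ffun 'I_3 -> T}) : Prop :=
  [/\ forall i, set_bij (P i) [set: T] (lab i),
      bijective phi
    & forall w i p, P i p -> p w -> phi w i = lab i p].

Definition diagonal_cube (Omega : Type) (P : 'I_3 -> set (set Omega))
    (L : set (set Omega)) (T : groupType) : Prop :=
  exists lab phi, @coordinatisation Omega P T lab phi /\
    [set phi @` letter | letter in L] =
      right_coset_partition (diagonal_subgroup T).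

(* Main.v *)
(* Fix a letter a.  It meets every layer exactly once, so its points label the
   layers in all three directions, and a becomes the diagonal of T^3, with a
   base point e.  The letter at (x, y, z) meets the layer x = e in one point
   (e, y', z'); regularity says that y' depends only on (x, y) and z' only on
   (x, z).  Comparing this with the meeting point with the layer y = e shows
   that one operation d gives both coordinates, and that
   d (d x y) (d x z) = d y z; with d e y = y and d x x = e this makes d the
   left division (x, y) |-> x^-1 * y of a group.  Two points then lie in the
   same letter iff they differ by a left diagonal translation.

   For uniqueness, the change of coordinates theta carries the translation by
   (s, s, s) at any given point to a translation by some (s', s', s').
   Comparing (1, 1, 1) with (t, 1, 1) shows that s' does not depend on t, so
   s |-> s' is a homomorphism. *)
Require Import Defs.
From HB Require Import structures.
From mathcomp Require Import all_boot.
From mathcomp Require Import boolp classical_sets functions cardinality.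

Set Implicit Arguments.
Unset Strict Implicit.
Unset Printing Implicit Defensive.

(** * Left divisions: the group of one, and one from a regular cube *)

Definition left_division (T : Type) (e : T) (d : T -> T -> T) : Prop :=
  [/\ forall y, d e y = y, forall x, d x x = e
    & forall x y z, d (d x y) (d x z) = d y z].

(** An alias of [T] indexed by [H], so that the group structure, which depends on [e] and [d], can
    be inferred from the type. *)
Definition division_group (T : Type) (e : T) (d : T -> T -> T)
  (H : left_division e d) : Type := T.

Section DivisionGroup.
Variables (T : Type) (e : T) (d : T -> T -> T) (H : left_division e d).
Local Notation G := (division_group H).

HB.instance Definition _ := gen_eqMixin G.
HB.instance Definition _ := gen_choiceMixin G.

Let inv (x : G) : G := d x e.
Let mul (x y : G) : G := d (inv x) y.

Let d1x y : d e y = y. Proof. by case: H. Qed.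
Let dxx x : d x x = e. Proof. by case: H. Qed.
Let ddd x y z : d (d x y) (d x z) = d y z. Proof. by case: H. Qed.

Let invd x y : d (d x y) e = d y x.
Proof. by rewrite -(dxx x) ddd. Qed.

Let invK x : inv (inv x) = x.
Proof. by rewrite /inv invd d1x. Qed.

Let dinv y z : d y (d (inv y) z) = z.
Proof. by rewrite -{1}(invK y) ddd d1x. Qed.

Fact division_mulA : associative mul.
(* [invd] turns the outer inverse into [d y (inv x)], and [z] is expanded to [d y (d (inv y) z)];
   the third law then cancels [y]. *)
Proof. by move=> x y z; rewrite /mul {3}/inv invd -{2}(dinv y z) ddd. Qed.

Fact division_mul1g : left_id (e : G) mul.
Proof. by move=> x; rewrite /mul /inv !d1x. Qed.

Fact division_mulg1 : right_id (e : G) mul.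
Proof. by move=> x; rewrite /mul -/(inv (inv x)) invK. Qed.

Fact division_mulVg : left_inverse (e : G) inv mul.
Proof. by move=> x; rewrite /mul invK dxx. Qed.

Fact division_mulgV : right_inverse (e : G) inv mul.
Proof. by move=> x; rewrite /mul dxx. Qed.

HB.instance Definition _ := isGroup.Build G division_mulA division_mul1g
  division_mulg1 division_mulVg division_mulgV.

Lemma division_groupE (x y : G) : d x y = (x^-1 * y)%g.
Proof. by rewrite -[x in LHS]invK. Qed.

End DivisionGroup.

(* [K x y z] is the letter at (x, y, z); [diag] says that the diagonal is a
   letter, and [reg..] that parallel lines sharing a letter have the same
   letters. *)
Lemma division_of_regular (T U : Type) (e : T) (K : T -> T -> T -> U)
    (injX : forall x y z y' z', K x y z = K x y' z' -> y = y' /\ z = z')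
    (injY : forall x y z x' z', K x y z = K x' y z' -> x = x' /\ z = z')
    (surjX : forall x y z x', exists y' z', K x y z = K x' y' z')
    (surjY : forall x y z y', exists x' z', K x y z = K x' y' z')
    (diag : forall x y, K x x x = K y y y)
    (regXY : forall x y z x' y' z', K x y z = K x' y' z' ->
       forall w, exists w', K x y w = K x' y' w')
    (regXZ : forall x y z x' y' z', K x y z = K x' y' z' ->
       forall w, exists w', K x w z = K x' w' z')
    (regYZ : forall x y z x' y' z', K x y z = K x' y' z' ->
       forall w, exists w', K w y z = K w' y' z') :
  exists d, left_division e d /\
    forall x y z, K x y z = K e (d x y) (d x z).
Proof.
(* One letter of the line [(x, y, _)], here the one at the arbitrary height [x], selects a line
   [(e, y', _)]; regularity carries over all the others. *)
have /choice[d12 d12P] : forall xy, exists y', forall z, exists z',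
    K xy.1 xy.2 z = K e y' z'.
  by move=> [x y]; have [y' [z' /regXY]] := surjX x y x e; exists y'.
have /choice[d13 d13P] : forall xz, exists z', forall y, exists y',
    K xz.1 y xz.2 = K e y' z'.
  by move=> [x z]; have [y' [z' /regXZ]] := surjX x x z e; exists z'.
have /choice[d23 d23P] : forall yz, exists z', forall x, exists x',
    K x yz.1 yz.2 = K x' e z'.
  by move=> [y z]; have [x' [z' /regYZ]] := surjY y y z e; exists z'.
have K1 x y z : K x y z = K e (d12 (x, y)) (d13 (x, z)).
  have [z1 /= E1] := d12P (x, y) z; have [y2 /= E2] := d13P (x, z) y.
  by rewrite E1; congr K; have [] := injX _ _ _ _ _ (etrans (esym E1) E2).
have d23E x y z x' z' : K x y z = K x' e z' -> d23 (y, z) = z'.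
  move=> E; have [x1 /= E1] := d23P (y, z) x.
  by have [] := injY _ _ _ _ _ (etrans (esym E1) E).
(* The letter at [(x, y, z)] also occurs at its meeting point with the layer [x = e]; from either
   point it reaches the same point of the layer [y = e]. *)
have d23d x y z : d23 (d12 (x, y), d13 (x, z)) = d23 (y, z).
  by have [x1 /= E1] := d23P (y, z) x; apply: (d23E e _ _ x1); rewrite -K1.
have d12xx x : d12 (x, x) = e.
  by have [] := injX _ _ _ _ _ (etrans (diag e x) (K1 x x x)).
have d13xx x : d13 (x, x) = e.
  by have [] := injX _ _ _ _ _ (etrans (diag e x) (K1 x x x)).
have d23xx x : d23 (x, x) = e by apply: (d23E x _ _ e); apply: diag.
have d13ey z : d13 (e, z) = z by have [] := injX _ _ _ _ _ (K1 e e z).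
have d23ey z : d23 (e, z) = z by apply: (d23E e _ _ e).
have d13d23 x z : d13 (x, z) = d23 (x, z) by rewrite -(d23d x) d12xx d23ey.
(* Both [(_, y, z)] and [(_, y, y)] share a letter with [(_, e, e)], so the letter at [(y, y, y)]
   occurs on [(_, y, z)]; it meets the layer of [y] only once. *)
have d23_eq y z : d23 (y, z) = e -> y = z.
  move=> E; have [x1 /= E1] := d23P (y, z) y; rewrite E in E1.
  have [x2 /= E2] := d23P (y, y) y; rewrite d23xx in E2.
  have [x3 E3] := regYZ _ _ _ _ _ _ (esym E1) x2.
  by have [] := injY _ _ _ _ _ (etrans E2 E3).
have d12d23 x y : d12 (x, y) = d23 (x, y).
  by apply: d23_eq; rewrite -(d13d23 x y) d23d d23xx.
exists (fun x y => d23 (x, y)); split=> [|x y z]; last first.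
  by rewrite {1}K1 d12d23 d13d23.
by split=> // x y z; rewrite -(d12d23 x y) -(d13d23 x z) d23d.
Qed.

Local Open Scope classical_set_scope.

(** * Partitions, regularity and cosets in terms of points *)

Section Parts.
Variable Omega : Type.
Implicit Types (P L : set (set Omega)) (w v : Omega).

(** A union of parts, hence total in [P] and [w] without any choice; for a partition it is the one
    part containing [w]. *)
Definition part_of P w : set Omega := [set v | exists p, [/\ P p, p w & p v]].

Lemma part_ofE P p w : is_partition P -> P p -> p w -> part_of P w = p.
Proof.
case=> _ disj _ Pp pw; apply/seteqP; split=> [v [q [Pq qw qv]]|v pv].
  by rewrite (disj p q) //; exists w.
by exists p.
Qed.

Lemma part_ofP P w : is_partition P -> P (part_of P w) /\ part_of P w w.
Proof.
move=> Ppart; have [cov _ _] := Ppart.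
have [p Pp pw] : cover P id w by rewrite cov.
by rewrite (part_ofE Ppart Pp pw).
Qed.

Lemma part_of_mem P p w v :
  is_partition P -> P p -> p w -> part_of P w = part_of P v -> p v.
Proof.
move=> PP Pp pw E; rewrite -(part_ofE PP Pp pw) E.
by case: (part_ofP v PP).
Qed.

Lemma eq_part_of P p w v :
  is_partition P -> P p -> p w -> p v -> part_of P w = part_of P v.
Proof. by move=> PP Pp pw pv; rewrite !(part_ofE PP Pp). Qed.

(** The dichotomy says that one shared letter, that of [v1] and [v2], forces every letter of the
    first line onto the second; the reverse inclusion follows by symmetry. *)
Lemma regular_cubeP (P : 'I_3 -> set (set Omega)) L :
    (forall i, is_partition (P i)) -> is_partition L ->
  regular_cube P L <->
  (forall i j v1 v2 w1, i != j -> part_of L v1 = part_of L v2 ->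
     part_of (P i) w1 = part_of (P i) v1 ->
     part_of (P j) w1 = part_of (P j) v1 ->
     exists w2, [/\ part_of (P i) w2 = part_of (P i) v2,
                    part_of (P j) w2 = part_of (P j) v2
                  & part_of L w2 = part_of L w1]).
Proof.
move=> PP LP; split=> [reg i j v1 v2 w1 ij Lv Pi Pj|reg l1 l2].
  pose l v := part_of (P i) v `&` part_of (P j) v.
  have lv v : l v v by split; have [] := part_ofP v (PP i);
    have [] := part_ofP v (PP j).
  have line v : partition_meet (P i) (P j) (l v).
    split; first by exists v.
    exists (part_of (P i) v), (part_of (P j) v).
    by split=> //; [have [] := part_ofP v (PP i)|have [] := part_ofP v (PP j)].
  have [Lv1 Lvv1] := part_ofP v1 LP; have [Lw1 Lww1] := part_ofP w1 LP.
  have par : parallel_lines P (l v1) (l v2) by exists i, j.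
  have w1l : letters_in L (l v1) (part_of L w1).
    split=> //; exists w1; split=> //; split.
      by rewrite -Pi; have [] := part_ofP w1 (PP i).
    by rewrite -Pj; have [] := part_ofP w1 (PP j).
  have [E|E] := reg _ _ par.
    move: w1l; rewrite E => -[_ [w2 [Lw2 [Piw2 Pjw2]]]]; exists w2; split.
    - by apply: part_ofE => //; have [] := part_ofP v2 (PP i).
    - by apply: part_ofE => //; have [] := part_ofP v2 (PP j).
    - exact: part_ofE.
  have [] : set0 (part_of L v1).
  rewrite -E; split; split=> //; first by exists v1.
  by exists v2; split=> //; rewrite Lv; have [] := part_ofP v2 LP.
case=> i [j [ij [_ [p1 [q1 [Pp1 Pq1 ->]]]] [_ [p2 [q2 [Pp2 Pq2 ->]]]]]].
have half p q p' q' : P i p -> P j q -> P i p' -> P j q' ->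
    letters_in L (p `&` q) `&` letters_in L (p' `&` q') !=set0 ->
    letters_in L (p `&` q) `<=` letters_in L (p' `&` q').
  move=> Pp Pq Pp' Pq'.
  move=> [a [[La [v1 [av1 [pv1 qv1]]]] [_ [v2 [av2 [pv2 qv2]]]]]].
  move=> b [Lb [w1 [bw1 [pw1 qw1]]]]; split=> //.
  have [w2 [Pi Pj Lw]] := reg i j v1 v2 w1 ij (eq_part_of LP La av1 av2)
    (eq_part_of (PP i) Pp pw1 pv1) (eq_part_of (PP j) Pq qw1 qv1).
  exists w2; split; first exact: part_of_mem LP Lb bw1 (esym Lw).
  split; first exact: part_of_mem (PP i) Pp' pv2 (esym Pi).
  exact: part_of_mem (PP j) Pq' qv2 (esym Pj).
have [->|/set0P ne] := eqVneq
  (letters_in L (p1 `&` q1) `&` letters_in L (p2 `&` q2)) set0; first by right.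
left; apply/seteqP; split; first exact: half.
by apply: half => //; rewrite setIC.
Qed.

Lemma coordinatisation_part (P : 'I_3 -> set (set Omega)) (T : groupType) lab
    (phi : Omega -> {ffun 'I_3 -> T}) i w v :
    (forall i, is_partition (P i)) -> coordinatisation P lab phi ->
  phi w i = phi v i <-> part_of (P i) w = part_of (P i) v.
Proof.
move=> PP [labP _ phiP]; have [Pw ww] := part_ofP w (PP i).
have [Pv vv] := part_ofP v (PP i).
rewrite (phiP _ _ _ Pw ww) (phiP _ _ _ Pv vv); split=> [|->] //.
by have [_ inj _] := labP i; apply: inj; rewrite inE.
Qed.

Lemma right_coset_diagonalE (T : groupType) (g x : {ffun 'I_3 -> T}) :
  [set (h * g)%g | h in diagonal_subgroup T] x <->
  exists t, forall i, x i = (t * g i)%g.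
Proof.
split=> [[_ [t _ <-] <-]|[t xE]].
  by exists t => i; rewrite !ffunE.
by exists [ffun=> t]; [exists t|apply/ffunP => i; rewrite !ffunE xE].
Qed.

(** Two partitions are equal iff they define the same equivalence relation; for right cosets of the
    diagonal it is left translation by a constant triple. *)
Lemma diagonal_lettersP L (T : groupType) (phi : Omega -> {ffun 'I_3 -> T}) :
    is_partition L -> bijective phi ->
  [set phi @` letter | letter in L] =
    right_coset_partition (diagonal_subgroup T) <->
  (forall w v, part_of L w = part_of L v <->
     exists t, forall i, phi v i = (t * phi w i)%g).
Proof.
move=> LP [psi phiK psiK]; split=> [E w v|E].
  have [Lw ww] := part_ofP w LP; have [Lv vv] := part_ofP v LP.
  have : right_coset_partition (diagonal_subgroup T) (phi @` part_of L w).
    by rewrite -E; exists (part_of L w).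
  move=> [g _ gE].
  have memg u : part_of L w u <-> exists t, forall i, phi u i = (t * g i)%g.
    rewrite -right_coset_diagonalE gE; split=> [|[u' wu']].
      by exists u.
    by move=> /(can_inj phiK) <-.
  have [t0 wg] := (memg w).1 ww.
  split=> [wv|[t vE]].
    have [|t vg] := (memg v).1; first by rewrite wv.
    by exists (t * t0^-1)%g => i; rewrite vg wg mulgA mulgVK.
  have : part_of L w v.
    by apply/memg; exists (t * t0)%g => i; rewrite vE wg mulgA.
  exact: eq_part_of.
have imE a w : L a -> a w ->
    phi @` a = [set (h * phi w)%g | h in diagonal_subgroup T].
  move=> La aw; apply/seteqP; split=> [_ [v av <-]|x].
    by apply/right_coset_diagonalE/E; apply: eq_part_of La aw av.
  move=> /right_coset_diagonalE; rewrite -(psiK x) => /E wx.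
  by exists (psi x) => //; exact: part_of_mem LP La aw wx.
apply/seteqP; split=> [_ [a La <-]|_ [g _ <-]].
  have [_ _ /(_ a La) [w aw]] := LP.
  by exists (phi w) => //; rewrite (imE _ _ La aw).
have [La aw] := part_ofP (psi g) LP.
by exists (part_of L (psi g)) => //; rewrite (imE _ _ La aw) psiK.
Qed.

End Parts.

(** * Coordinates on a Latin cube; diagonal cubes are regular *)

Section LatinCube.
Variables (Omega : Type) (P : 'I_3 -> set (set Omega)) (L : set (set Omega)).
Hypothesis hL : latin_cube P L.

Let PP i : is_partition (P i). Proof. by case: hL => -[]. Qed.
Let LP : is_partition L. Proof. by case: hL. Qed.

Lemma cube_point (v : 'I_3 -> Omega) :
  exists w, forall i, part_of (P i) w = part_of (P i) (v i).
Proof.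
have [[_ _ cart] _ _ _] := hL.
have Pv i : P i (part_of (P i) (v i)) by have [] := part_ofP (v i) (PP i).
have [w wE] := cart _ Pv; exists w => i; apply: part_ofE => //.
have : [set w] w by [].
by rewrite -wE => /(_ i); apply.
Qed.

Lemma cube_inj w v : (forall i, part_of (P i) w = part_of (P i) v) -> w = v.
Proof.
have [[_ _ cart] _ _ _] := hL.
have Pw i := part_ofP w (PP i); have Pv i := part_ofP v (PP i).
have [u uE] := cart _ (fun i => (Pw i).1); move=> wv.
have -> : w = u.
  suff : [set u] w by [].
  by rewrite -uE => i _; have [] := Pw i.
suff : [set u] v by [].
by rewrite -uE => i _; rewrite wv; have [] := Pv i.
Qed.

Lemma latin_point i w v :
  exists u, part_of (P i) u = part_of (P i) w /\ part_of L u = part_of L v.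
Proof.
have [_ _ _ /(_ i _ _ (part_ofP w (PP i)).1 (part_ofP v LP).1)[u uE]] := hL.
have : [set u] u by [].
rewrite -uE => -[uw uv]; exists u; split; apply: part_ofE => //.
  by have [] := part_ofP w (PP i).
by have [] := part_ofP v LP.
Qed.

Lemma latin_inj i w v :
  part_of (P i) w = part_of (P i) v -> part_of L w = part_of L v -> w = v.
Proof.
have [Pw ww] := part_ofP w (PP i); have [Lw lww] := part_ofP w LP.
have [_ _ _ /(_ i _ _ Pw Lw)[u uE]] := hL.
move=> Pwv Lwv; have -> : w = u.
  suff : [set u] w by [].
  by rewrite -uE.
suff : [set u] v by [].
rewrite -uE; split; first by rewrite Pwv; have [] := part_ofP v (PP i).
by rewrite Lwv; have [] := part_ofP v LP.
Qed.

(* A letter meets every layer once, so its points label all three sets of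
   layers, and with these labels it becomes the diagonal. *)
Lemma letter_coordinates : exists (T : Type) (e : T)
    (phi : Omega -> {ffun 'I_3 -> T}),
  [/\ bijective phi,
      forall i w v, part_of (P i) w = part_of (P i) v <-> phi w i = phi v i
    & forall w v s t, phi w = [ffun=> s] -> phi v = [ffun=> t] ->
        part_of L w = part_of L v].
Proof.
(* Having parts makes [Omega] inhabited. The letter of a point [o] serves as the label set, with [o]
   as base point. *)
have [[_ /(_ ord0)[p [_ [Pp _ _]]] _] _ _ _] := hL.
have [_ _ /(_ p Pp)[o _]] := PP ord0.
pose T := {u : Omega | part_of L u = part_of L o}.
have Tval_inj (s t : T) : sval s = sval t -> s = t.
  by case: s t => s Ls [t Lt] /= st; apply: eq_exist.
have /choice[phi phiP] : forall w, exists x : {ffun 'I_3 -> T},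
    forall i, part_of (P i) (sval (x i)) = part_of (P i) w.
  move=> w; have /choice[x xP] : forall i, exists u : T,
      part_of (P i) (sval u) = part_of (P i) w.
    by move=> i; have [u [Pu Lu]] := latin_point i w o; exists (exist _ u Lu).
  by exists [ffun i => x i] => i; rewrite ffunE.
have phiE i w v : part_of (P i) w = part_of (P i) v <-> phi w i = phi v i.
  split=> [wv|wv]; last by rewrite -(phiP w) wv phiP.
  apply: Tval_inj; apply: (latin_inj (i := i)); first by rewrite !phiP.
  by rewrite (svalP (phi w i)) (svalP (phi v i)).
exists T, (exist (fun u => part_of L u = part_of L o) o erefl), phi; split=> //.
  have /choice[psi psiP] : forall x : {ffun 'I_3 -> T}, exists w,
      forall i, part_of (P i) w = part_of (P i) (sval (x i)).
    by move=> x; apply: (cube_point (fun i => sval (x i))).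
  exists psi => [w|x].
    by apply: cube_inj => i; rewrite psiP phiP.
  apply/ffunP => i; apply: Tval_inj; apply: (latin_inj (i := i)).
    by rewrite phiP psiP.
  by rewrite (svalP (phi _ i)) (svalP (x i)).
(* A point with all three labels equal to [s] lies in the same layers as the point [s], hence is
   that point of the chosen letter. *)
have const w (s : T) : phi w = [ffun=> s] -> part_of L w = part_of L o.
  move=> ws; have -> : w = sval s; last exact: svalP s.
  by apply: cube_inj => i; rewrite -(phiP w) ws ffunE.
by move=> w v s t /const -> /const ->.
Qed.

Lemma diagonal_cube_of_part (T : groupType) (phi : Omega -> {ffun 'I_3 -> T}) :
    bijective phi ->
    (forall i w v, part_of (P i) w = part_of (P i) v <-> phi w i = phi v i) ->
    (forall w v, part_of L w = part_of L v <->
       exists t, forall i, phi v i = (t * phi w i)%g) ->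
  diagonal_cube P L T.
Proof.
move=> phi_bij phiE LE.
have /choice[lab0 labP] : forall ip : 'I_3 * set Omega, exists t,
    P ip.1 ip.2 -> forall w, ip.2 w -> phi w ip.1 = t.
  (* The label of a layer is the coordinate shared by its points; [1] is a dummy value for sets that
     are not layers. *)
  move=> [i p] /=; have [Pp|nPp] := pselect (P i p); last by exists 1%g.
  have [_ _ /(_ p Pp)[v pv]] := PP i; exists (phi v i) => _ w pw.
  by apply/phiE/(eq_part_of (PP i) Pp).
pose lab i p := lab0 (i, p).
have labE i p w : P i p -> p w -> phi w i = lab i p.
  by move=> Pp pw; apply: labP (i, p) Pp w pw.
exists lab, phi; split; last exact/diagonal_lettersP.
split=> [i|//|w i p]; last exact: labE.
split=> [//|p q|t _].
  rewrite !inE => Pp Pq.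
  have [_ _ /[dup] /(_ p Pp)[w pw] /(_ q Pq)[v qv]] := PP i.
  rewrite -(labE i p w) // -(labE i q v) // => /phiE wv.
  by rewrite -(part_ofE (PP i) Pp pw) -(part_ofE (PP i) Pq qv).
have [psi phiK psiK] := phi_bij.
have [Pw ww] := part_ofP (psi [ffun=> t]) (PP i).
by exists (part_of (P i) (psi [ffun=> t])) => //;
  rewrite -(labE i _ _ Pw ww) psiK ffunE.
Qed.

Lemma diagonal_cube_regular (T : groupType) :
  diagonal_cube P L T -> regular_cube P L.
Proof.
move=> [lab [phi [coord /diagonal_lettersP LE]]].
have [_ phi_bij _] := coord; have {}LE := LE LP phi_bij.
have phiE := coordinatisation_part _ _ _ PP coord.
apply/regular_cubeP => // i j v1 v2 w1 _ /LE[t v12] /phiE wi /phiE wj.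
have [psi phiK psiK] := phi_bij.
(* The translation taking [v1] to [v2] is applied to [w1], which agrees with [v1] in the coordinates
   [i] and [j]. *)
exists (psi [ffun k => t * phi w1 k]%g); split.
- by apply/phiE; rewrite psiK ffunE wi v12.
- by apply/phiE; rewrite psiK ffunE wj v12.
- by apply/esym/LE; exists t => k; rewrite psiK ffunE.
Qed.

(** * From regular cubes to diagonal cubes *)

Definition triple (T : Type) (x y z : T) : {ffun 'I_3 -> T} :=
  [ffun i : 'I_3 => nth x [:: x; y; z] i].

Lemma ord3P (i : 'I_3) : i = ord0 \/ i = inord 1 \/ i = inord 2.
Proof.
case: i => [[|[|[|//]]] lti]; [left|right; left|right; right];
  by apply: val_inj; rewrite /= ?inordK.
Qed.

(** A product of equations, so that one [rewrite] evaluates all three coordinates. *)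
Lemma tripleE (T : Type) (x y z : T) :
  (triple x y z ord0 = x) * (triple x y z (inord 1) = y) *
  (triple x y z (inord 2) = z).
Proof. by rewrite !ffunE !inordK. Qed.

Lemma triple_ext (T : Type) (f g : {ffun 'I_3 -> T}) :
  f ord0 = g ord0 -> f (inord 1) = g (inord 1) -> f (inord 2) = g (inord 2) ->
  f = g.
Proof. by move=> e0 e1 e2; apply/ffunP => i; have [->|[->|->]] := ord3P i. Qed.

Lemma triple_eta (T : Type) (f : {ffun 'I_3 -> T}) :
  triple (f ord0) (f (inord 1)) (f (inord 2)) = f.
Proof. by apply: triple_ext; rewrite tripleE. Qed.

Lemma regular_diagonal_cube :
  regular_cube P L -> exists T : groupType, diagonal_cube P L T.
Proof.
move=> /(regular_cubeP PP LP) reg.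
have [T [e [phi [phi_bij phiE diag]]]] := letter_coordinates.
have [psi phiK psiK] := phi_bij.
pose K x y z := part_of L (psi (triple x y z)).
have KE w : part_of L w = K (phi w ord0) (phi w (inord 1)) (phi w (inord 2)).
  by rewrite /K triple_eta phiK.
have inj i (f g : {ffun 'I_3 -> T}) :
    f i = g i -> part_of L (psi f) = part_of L (psi g) -> f = g.
  move=> fg Lfg; apply: (can_inj psiK); apply: (latin_inj (i := i)) => //.
  by apply/phiE; rewrite !psiK.
have surj i f t : exists g : {ffun 'I_3 -> T},
    g i = t /\ part_of L (psi f) = part_of L (psi g).
  have [u [/phiE Pu Lu]] := latin_point i (psi [ffun=> t]) (psi f).
  by exists (phi u); rewrite phiK Pu psiK ffunE.
have {}reg i j (f g f' : {ffun 'I_3 -> T}) :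
    i != j -> part_of L (psi f) = part_of L (psi g) ->
    f' i = f i -> f' j = f j -> exists g' : {ffun 'I_3 -> T},
    [/\ g' i = g i, g' j = g j & part_of L (psi f') = part_of L (psi g')].
  move=> ij fg f'i f'j.
  have [|| w [/phiE Pi /phiE Pj Lw]] := reg i j (psi f) (psi g) (psi f') ij fg.
  - by apply/phiE; rewrite !psiK.
  - by apply/phiE; rewrite !psiK.
  by exists (phi w); rewrite phiK Pi Pj psiK.
have ne01 : ord0 != inord 1 :> 'I_3 by rewrite -val_eqE /= inordK.
have ne02 : ord0 != inord 2 :> 'I_3 by rewrite -val_eqE /= inordK.
have ne12 : inord 1 != inord 2 :> 'I_3 by rewrite -val_eqE /= !inordK.
have injX x y z y' z' : K x y z = K x y' z' -> y = y' /\ z = z'.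
  move=> /(inj ord0); rewrite !tripleE => /(_ erefl) /ffunP E.
  by split; [have := E (inord 1)|have := E (inord 2)]; rewrite !tripleE.
have [||||||||d [dP Kd]] := @division_of_regular T _ e K.
- exact: injX.
- move=> x y z x' z' /(inj (inord 1)); rewrite !tripleE => /(_ erefl) /ffunP E.
  by split; [have := E ord0|have := E (inord 2)]; rewrite !tripleE.
- move=> x y z x'; have [g [<- gE]] := surj ord0 (triple x y z) x'.
  by exists (g (inord 1)), (g (inord 2)); rewrite /K triple_eta.
- move=> x y z y'; have [g [<- gE]] := surj (inord 1) (triple x y z) y'.
  by exists (g ord0), (g (inord 2)); rewrite /K triple_eta.
- move=> x y; apply: (diag _ _ x y); rewrite psiK;
    by apply: triple_ext; rewrite tripleE ffunE.
- move=> x y z x' y' z' E w.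
  have [||g [g0 g1 gE]] := reg _ _ _ _ (triple x y w) ne01 E;
    [by rewrite !tripleE..|rewrite !tripleE in g0 g1].
  by exists (g (inord 2)); rewrite /K -g0 -g1 triple_eta.
- move=> x y z x' y' z' E w.
  have [||g [g0 g2 gE]] := reg _ _ _ _ (triple x w z) ne02 E;
    [by rewrite !tripleE..|rewrite !tripleE in g0 g2].
  by exists (g (inord 1)); rewrite /K -g0 -g2 triple_eta.
- move=> x y z x' y' z' E w.
  have [||g [g1 g2 gE]] := reg _ _ _ _ (triple w y z) ne12 E;
    [by rewrite !tripleE..|rewrite !tripleE in g1 g2].
  by exists (g ord0); rewrite /K -g1 -g2 triple_eta.
exists (division_group dP).
apply: (@diagonal_cube_of_part _ (phi : _ -> {ffun 'I_3 -> division_group dP})).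
- exact: phi_bij.
- exact: phiE.
have dE (x y : division_group dP) : d x y = (x^-1 * y)%g.
  exact: division_groupE.
(* Both letters are read off in the layer [x = e], so they are equal iff the quotients by the first
   coordinate agree; that coordinate then forces the translation. *)
move=> w v; rewrite !KE Kd [K (phi v ord0) _ _]Kd !dE.
split=> [/injX[E1 E2]|[t vE]]; last first.
  by rewrite !vE !invgM -!mulgA !mulKg.
exists ((phi v ord0 : division_group dP) *
        (phi w ord0 : division_group dP)^-1)%g => i.
have [->|[->|->]] := ord3P i.
- by rewrite mulgVK.
- by rewrite -mulgA E1 mulVKg.
- by rewrite -mulgA E2 mulVKg.
Qed.

(** * Uniqueness of the group *)

Lemma diagonal_cube_unique (T T' : groupType) :
    diagonal_cube P L T -> diagonal_cube P L T' ->
  exists f : {multiplicative T -> T'}, bijective f.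
Proof.
move=> [lab [phi [coord /diagonal_lettersP LE]]].
move=> [lab' [phi' [coord' /diagonal_lettersP LE']]].
have [[_ phi_bij _] [_ phi'_bij _]] := (coord, coord').
have {}LE := LE LP phi_bij; have {}LE' := LE' LP phi'_bij.
have [[psi phiK psiK] [psi' phi'K psi'K]] := (phi_bij, phi'_bij).
have phiE := coordinatisation_part _ _ _ PP coord.
have phi'E := coordinatisation_part _ _ _ PP coord'.
(* Each new coordinate depends only on the old one of the same index, so constant triples suffice to
   define the change of labels. *)
pose theta i t := phi' (psi [ffun=> t]) i.
have thetaE w i : phi' w i = theta i (phi w i).
  by apply/phi'E/phiE; rewrite psiK ffunE.
have thetaI i : injective (theta i).
  by move=> s t /phi'E/phiE; rewrite !psiK !ffunE.
have theta_surj t' : exists t, theta ord0 t = t'.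
  by exists (phi (psi' [ffun=> t']) ord0); rewrite -thetaE psi'K ffunE.
have transl s (f : {ffun 'I_3 -> T}) :
    exists s', forall i, theta i (s * f i)%g = (s' * theta i (f i))%g.
  have /LE'[s' E] : part_of L (psi f) =
      part_of L (psi [ffun i => s * f i]%g).
    by apply/LE; exists s => i; rewrite !psiK ffunE.
  by exists s' => i; have := E i; rewrite !thetaE !psiK ffunE.
pose tau s := (theta ord0 s * (theta ord0 1)^-1)%g.
have tauE s t : theta ord0 (s * t)%g = (tau s * theta ord0 t)%g.
  (* Both base points have second entry [1], where cancellation gives [s1 = s2]; the first
     coordinate then yields the equation. *)
  have [s1 E1] := transl s [ffun=> 1%g].
  have [s2 E2] := transl s (triple t 1%g 1%g).
  have := E1 ord0; have := E1 (inord 1).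
  have := E2 ord0; have := E2 (inord 1).
  rewrite !tripleE !ffunE !mulg1 => -> -> /mulIg -> E.
  by rewrite /tau E mulgK.
have tauM : {morph tau : s t / (s * t)%g}.
  by move=> s t; rewrite {1}/tau tauE -mulgA.
pose f : {multiplicative T -> T'} :=
  HB.pack tau (isMultiplicative.Build T T' tau tauM).
(* [tau] is the bijection [theta ord0] followed by a right translation that sends the image of [1]
   to [1]. *)
exists f; have /choice[g gK] := theta_surj.
exists (fun t' => g (t' * theta ord0 1)%g) => [t|t'] /=.
  by apply: (thetaI ord0); rewrite gK /tau mulgVK.
by rewrite /tau gK mulgK.
Qed.

End LatinCube.

Theorem theorem1p2 (Omega : Type) (P : 'I_3 -> set (set Omega))
    (L : set (set Omega)) (hL : latin_cube P L) :
  (regular_cube P L <-> exists T : groupType, diagonal_cube P L T) /\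
  (forall T T' : groupType, diagonal_cube P L T -> diagonal_cube P L T' ->
     exists f : {multiplicative T -> T'}, bijective f).
Proof.
split; last exact: diagonal_cube_unique.
split=> [|[T]]; first exact: regular_diagonal_cube.
exact: diagonal_cube_regular.
Qed.
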